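(* Let $m>k\ge2$ be integers. Suppose that $D\in\mathcal{D}_k$ has only trivial 3-bonds, and consider a balanced weighting of $D$ with total weight $m$, together with the graph $G\in\mathcal{B}_m(D)$ it yields. \begin{enumerate} \item[(a)] If $D$ has balanced $\pi^{\mathrm v}$-values, then $G$ minimizes $d_3(\cdot)$ in $\mathcal{B}_m(D)$. \item[(b)] If $m\ge2k$, then $G$ minimizes $d_3(\cdot)$ in $\mathcal{B}_m(D)$ if and only if $D$ has balanced $\pi^{\mathrm v}$-values. \end{enumerate}
   Context: Graphs are finite connected multigraphs, considered up to isomorphism. $d_i(G)$ is the number of sets of $i$ edges of $G$ whose deletion disconnects $G$. $\mathcal{D}_k$ is the set of 3-edge-connected cubic graphs with $2k$ vertices and $3k$ edges. A weighting of $D\in\mathcal{D}_k$ assigns to each edge $e$ a nonnegative integer $\ell(e)$ such that every cycle of $D$ has positive total weight; it yields the weak subdivision of $D$ obtained by contracting each edge of weight $0$ and replacing each edge of weight $\ell\ge1$ by a path with $\ell$ edges. The weighting (and the resulting graph) is balanced if all weights pairwise differ by at most one. $\mathcal{B}_m(D)$ is the set of graphs with $m$ edges that arise from balanced weightings of $D$ (necessarily of total weight $m$). Write $m=3kq+r$ with integers $q,r$ and $-3k/2<r\le 3k/2$; then a balanced weighting of total weight $m$ has $3k-|r|$ edges of weight $q$ and $|r|$ edges of weight $q+1$ (if $r>0$) or $q-1$ (if $r<0$). For a vertex $u$ of $D$, $\pi^{\mathrm v}(u)$ is the number of edges incident to $u$ of weight $q+1$ minus the number of edges incident to $u$ of weight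 $q-1$. The $\pi^{\mathrm v}$-values of $D$ are balanced if they pairwise differ by at most one. A bond is a minimal cut (a minimal edge set among sets of edges crossing a partition of the vertices into two nonempty sets); a 3-bond is a bond with three edges. A 3-bond of $D$ is trivial if it consists of the three edges incident to some vertex. *)

(* Defs.v *)
From mathcomp Require Import all_boot all_order all_algebra.
Set Implicit Arguments.
Unset Strict Implicit.
Unset Printing Implicit Defensive.
Import Order.TTheory GRing.Theory Num.Theory.

(* Finite multigraphs, with loops and parallel edges. The orientation of an
   edge from esrc to etgt is only a way of naming its two ends: no notion
   below depends on it, and mgraph_iso may reverse edges. *)
Record mgraph := MGraph {
  vert : finType;
  edge : finType;
  esrc : edge -> vert;
  etgt : edge -> vert }.

Section Graph.
Variable G : mgraph.
Implicit Types (A C S : {set edge G}) (X : {set vert G}) (u v : vert G).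

Definition incident u (e : edge G) : bool := (esrc e == u) || (etgt e == u).

Definition star u : {set edge G} := [set e | incident u e].

(* Degree of v in the spanning subgraph with edge set A; a loop counts twice. *)
Definition deg_in A v : nat :=
  #|[set e in A | esrc e == v]| + #|[set e in A | etgt e == v]|.

Definition adj_in A : rel (vert G) := fun u v =>
  [exists e in A, ((esrc e == u) && (etgt e == v))
               || ((esrc e == v) && (etgt e == u))].

(* The spanning subgraph with edge set A is connected. *)
Definition connected_in A : bool :=
  (0 < #|vert G|) && [forall u, forall v, connect (adj_in A) u v].

Definition disconnecting S : bool := ~~ connected_in (~: S).

Definition d (i : nat) : nat :=
  #|[set S : {set edge G} | (#|S| == i) && disconnecting S]|.

Definition cubic : Prop := forall v, deg_in setT v = 3.

Definition three_edge_connected : Prop :=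
  forall S, #|S| < 3 -> connected_in (~: S).

(* Edge sets of cycles, i.e. of connected 2-regular subgraphs; in particular
   a loop and a pair of parallel edges are cycles. *)
Definition is_cycle C : Prop :=
  [/\ C != set0,
      forall v, 0 < deg_in C v -> deg_in C v = 2
    & forall u v, 0 < deg_in C u -> 0 < deg_in C v ->
        connect (adj_in C) u v].

Definition crossing X : {set edge G} :=
  [set e | (esrc e \in X) != (etgt e \in X)].

Definition is_cut S : bool :=
  [exists X : {set vert G}, [&& X != set0, X != setT & S == crossing X]].

Definition is_bond S : bool := minset is_cut S.

Definition only_trivial_3bonds : Prop :=
  forall S, is_bond S -> #|S| = 3 -> exists u, S = star u.

End Graph.

Definition in_D (k : nat) (D : mgraph) : Prop :=
  [/\ #|vert D| = 2 * k, #|edge D| = 3 * k, cubic D & three_edge_connected D].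

Definition mgraph_iso (G H : mgraph) : Prop :=
  exists (f : vert G -> vert H) (g : edge G -> edge H),
    [/\ bijective f, bijective g
      & forall e, (esrc (g e) = f (esrc e) /\ etgt (g e) = f (etgt e))
               \/ (esrc (g e) = f (etgt e) /\ etgt (g e) = f (esrc e))].

Section Weighting.
Variables (D : mgraph) (l : edge D -> nat).

Definition weighting : Prop :=
  forall C : {set edge D}, is_cycle C -> 0 < \sum_(e in C) l e.

Definition total_weight : nat := \sum_(e : edge D) l e.

Definition balanced : Prop := forall e f, l e <= l f + 1.

(* Vertices of the graph obtained by contracting the edges of weight 0. *)
Definition zero_class (v : vert D) : {set vert D} :=
  [set u | connect (adj_in [set e | l e == 0]) v u].

Definition contracted_vert : finType :=
  {X : {set vert D} | X \in codom zero_class}.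

Definition contract (v : vert D) : contracted_vert :=
  exist _ (zero_class v) (codom_f zero_class v).

(* In addition, an edge of weight w contributes w.-1 inner vertices. *)
Definition wsub_vert : finType :=
  (contracted_vert + {e : edge D & 'I_(l e).-1})%type.

Definition wsub_edge : finType := {e : edge D & 'I_(l e)}.

(* The j-th vertex, 0 <= j <= l e, on the path that replaces an edge e with
   0 < l e: the ends of e for j = 0 and j = l e (when insub fails), and inner
   vertices in between. *)
Definition path_vert (e : edge D) (j : nat) : wsub_vert :=
  if j is i.+1 then
    if (insub i : option 'I_(l e).-1) is Some x
    then inr (Tagged (fun e' => 'I_(l e').-1) x)
    else inl (contract (etgt e))
  else inl (contract (esrc e)).

Definition weak_subdivision : mgraph :=
  @MGraph wsub_vert wsub_edge
    (fun x => path_vert (tag x) (tagged x))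
    (fun x => path_vert (tag x) (tagged x).+1).

Definition pi_v (q : int) (u : vert D) : int :=
  (#|[set e in star u | (l e)%:Z == q + 1]|%:Z
   - #|[set e in star u | (l e)%:Z == q - 1]|%:Z)%R.

Definition balanced_pi_v (q : int) : Prop :=
  forall u v : vert D, (`|pi_v q u - pi_v q v| <= 1)%R.

End Weighting.

Definition in_B (m : nat) (D G : mgraph) : Prop :=
  #|edge G| = m /\
  exists l : edge D -> nat,
    [/\ weighting l, balanced l & mgraph_iso G (weak_subdivision l)].

Definition minimizes_d3_in_B (m : nat) (D G : mgraph) : Prop :=
  in_B m D G /\ forall H : mgraph, in_B m D H -> d G 3 <= d H 3.

(* Main.v *)
Require Import Defs.
From mathcomp Require Import all_boot all_order all_algebra.
From mathcomp Require Import zify.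
Import Order.TTheory GRing.Theory Num.Theory.
Set Implicit Arguments.
Unset Strict Implicit.
Unset Printing Implicit Defensive.

(** Let [l] be a weighting of [D] of total weight [m] and [G] its weak
    subdivision. A set [T] of three edges of [G] disconnects [G] if and only if
    two of its edges lie on the same path, or its edges lie on three different
    paths and the three corresponding edges of [D] disconnect [D]
    ([disconnecting_noninj], [disconnecting_lift], [disconnecting_proj]). As [D]
    is 3-edge-connected and has only trivial 3-bonds, the disconnecting triples
    of [D] are the stars of its vertices, and distinct vertices have distinct
    stars. Counting gives [d3_formula]: d_3(G) plus the third elementary
    symmetric function of the weights equals 'C(m, 3) plus the sum, over the
    vertices of [D], of the product of the three incident weights.

    A balanced weighting of total weight [m] takes the value [w] on a set [S] of
    |r| edges and the value [Q = q] elsewhere, where [w] is [q + 1] or [q - 1]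
    according to the sign of [r] ([balanced_two_valued]). The multiset of
    weights, hence the symmetric function, depends on [m] and [D] only, and what
    has to be minimized is the sum over [u] of [w ^ a * Q ^ (3 - a)], where [a]
    is the degree of [u] in [S]. This is a convex function of [a], and the
    degrees sum to 2|r|. Bounding it below by the chord through two consecutive
    values [t] and [t + 1] shows that degrees which pairwise differ by at most
    one, that is, balanced pi-values, give the minimum
    ([vsum_le_near_regular]).

    For the converse, if some set [S'] of |r| edges has all degrees in
    [{t, t + 1}] then a minimizer attains the chord bound at every vertex, and
    the bound is strict off [{t, t + 1}] ([vsum_min_near_regular]); the
    hypothesis m >= 2k excludes the values of [Q], [w] and [t] for which strictness
    fails, and also guarantees that the weighting with value [w] on [S'] gives
    every cycle positive weight. Such an [S'] exists by [near_regular_exists].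
    For |r| <= k it is part of a perfect matching, and for k < |r| <= 3k/2 a
    perfect matching together with a matching of size |r| - k in the
    complementary 2-factor.

    The perfect matching is Petersen's theorem ([petersen]). Let [A] be a largest
    vertex set whose deletion lowers the matching number by at least #|A|. Then
    every vertex outside [A] is missed by some maximum matching of [D - A], so by
    Gallai's lemma a maximum matching of [D - A] misses at most one vertex of
    each component of [D - A]. If there is no perfect matching, at least
    #|A| + 2 vertices outside [A] are missed; each of their components sends at
    least three edges to [A], which receives at most 3#|A| edges, a
    contradiction. *)

(** * Degrees, cuts and matchings *)

Section Cuts.
Variable G : mgraph.
Implicit Types (A S M N : {set edge G}) (X : {set vert G}) (u v w : vert G).

(** The number of ends of [e] at [v]; it is 2 for a loop. *)
Definition ends (e : edge G) v : nat := (esrc e == v) + (etgt e == v).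

Lemma ends_gt0 e v : (0 < ends e v) = incident v e.
Proof. by rewrite /ends /incident; do 2!case: (_ == _). Qed.

Lemma sum_ends e : \sum_v ends e v = 2.
Proof.
have pick1 w : \sum_v (w == v :> vert G) = 1.
  by rewrite (bigD1 w) //= eqxx big1 // => v; rewrite eq_sym => /negbTE->.
by rewrite big_split /= !pick1.
Qed.

Lemma deg_inE A v : deg_in A v = \sum_(e in A) ends e v.
Proof.
rewrite big_split /= /deg_in; congr addn;
  rewrite -sum1_card [RHS]big_mkcond [LHS]big_mkcond /=;
  apply: eq_bigr => e _; rewrite inE; case: (e \in A) => //=;
  by case: (_ == _).
Qed.

(** The handshake lemma. *)
Lemma sum_deg_in A : \sum_v deg_in A v = 2 * #|A|.
Proof.
under eq_bigr do rewrite deg_inE.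
rewrite exchange_big /= (eq_bigr (fun=> 2)) => [|e _]; last exact: sum_ends.
by rewrite sum_nat_const mulnC.
Qed.

Lemma deg_in_gt0P A v :
  reflect (exists2 e, e \in A & incident v e) (0 < deg_in A v).
Proof.
rewrite deg_inE lt0n sum_nat_eq0 negb_forall.
apply: (iffP existsP) => [[e]|[e eA ve]]; first last.
  by exists e; rewrite eA -lt0n ends_gt0.
by rewrite negb_imply -lt0n ends_gt0 => /andP[eA ve]; exists e.
Qed.

Lemma deg_inU1 e A v : e \notin A -> deg_in (e |: A) v = ends e v + deg_in A v.
Proof. by move=> eA; rewrite !deg_inE big_setU1. Qed.

Lemma deg_inD1 e A v : e \in A -> deg_in A v = ends e v + deg_in (A :\ e) v.
Proof. by move=> eA; rewrite !deg_inE (big_setD1 e). Qed.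

Lemma deg_inS A S v : A \subset S -> deg_in A v <= deg_in S v.
Proof.
move=> AS; rewrite !deg_inE [X in _ <= X](bigID (mem A)) /=.
rewrite [X in _ <= X + _](eq_bigl (mem A)); first exact: leq_addr.
by move=> e /=; case eA: (e \in A); rewrite ?andbT ?andbF // (subsetP AS).
Qed.

Lemma deg_in_setU A S v :
  [disjoint A & S] -> deg_in (A :|: S) v = deg_in A v + deg_in S v.
Proof. by move=> AS; rewrite !deg_inE -bigU //; apply: eq_bigl => e; rewrite inE. Qed.

Lemma adj_in_sym A : symmetric (adj_in A).
Proof.
by move=> u v; apply/existsP/existsP => -[e]; rewrite orbC => eA; exists e.
Qed.

Lemma adj_in_ends A e : e \in A -> adj_in A (esrc e) (etgt e).
Proof. by move=> eA; apply/existsP; exists e; rewrite eA !eqxx. Qed.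

Lemma connect_adj_sym A : connect_sym (adj_in A).
Proof. exact/sym_connect_sym/adj_in_sym. Qed.

(** Removing [S] disconnects the graph exactly when [S] contains all the
    edges between some nonempty proper vertex set and its complement. *)
Lemma disconnectingP S : 0 < #|vert G| ->
  reflect (exists X, [/\ X != set0, X != setT & crossing X \subset S])
          (disconnecting S).
Proof.
move=> V0; rewrite /disconnecting /connected_in V0 /= negb_forall.
apply: (iffP existsP) => [[u]|[X [/set0Pn[u uX] XT XS]]].
  rewrite negb_forall => /existsP[v uv].
  exists [set w | connect (adj_in (~: S)) u w]; split.
  - by apply/set0Pn; exists u; rewrite inE connect0.
  - by apply: contraNneq uv => /setP/(_ v); rewrite !inE => ->.
  - apply/subsetP => e; rewrite !inE; apply: contraR => eS.
    have/connect1 c : adj_in (~: S) (esrc e) (etgt e).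
      by apply: adj_in_ends; rewrite inE.
    by rewrite (same_connect_r (@connect_adj_sym _) c) eqxx.
have [v vX] : exists v, v \notin X.
  by apply/existsP; rewrite -negb_forall; apply: contra XT => /forallP XA;
     apply/eqP/setP => w; rewrite inE XA.
exists u; rewrite negb_forall; apply/existsP; exists v.
apply/negP => /(closed_connect (a := mem X)) /= cl.
suff: (u \in X) = (v \in X) by rewrite uX (negbTE vX).
apply: cl => x y /existsP[e /andP[]]; rewrite inE => eS.
have := contra (subsetP XS e) eS; rewrite inE negbK => /eqP exy.
by case/orP => /andP[/eqP <- /eqP <-].
Qed.

Lemma cut_ge3 X : three_edge_connected G ->
  X != set0 -> X != setT -> 3 <= #|crossing X|.
Proof.
move=> tec X0 XT; rewrite leqNgt; apply/negP => /tec.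
apply/negP; apply/disconnectingP; last by exists X.
by case/set0Pn: X0 => u _; apply/card_gt0P; exists u.
Qed.

(** Loops count twice in degrees, so they belong to no matching. *)
Definition matching M : bool := [forall v, deg_in M v <= 1].

(** The vertices covered by [M]. *)
Definition covered M : {set vert G} := [set v | 0 < deg_in M v].

Lemma card_covered M : matching M -> #|covered M| = 2 * #|M|.
Proof.
move=> /forallP mM; rewrite -sum_deg_in -sum1_card big_mkcond /=.
by apply: eq_bigr => v _; rewrite inE; case: deg_in (mM v) => [|[]].
Qed.

Lemma matching_setU1 M e : matching M -> esrc e != etgt e ->
  (forall v, incident v e -> v \notin covered M) ->
  e \notin M /\ matching (e |: M).
Proof.
move=> mM ne cM; have eM : e \notin M.
  apply/negP => eM; have := cM (esrc e); rewrite /incident eqxx => /(_ isT).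
  rewrite inE => /negP; apply; apply/deg_in_gt0P.
  by exists e; rewrite // /incident eqxx.
split=> //; apply/forallP => v; rewrite deg_inU1 //.
have [iv|niv] := boolP (incident v e).
  have := cM v iv; rewrite inE -eqn0Ngt => /eqP->; rewrite addn0 /ends.
  by case: (esrc e =P v) => [<-|]; rewrite ?[etgt e == _]eq_sym ?(negbTE ne) //;
    case: (_ == _).
by move: niv; rewrite -ends_gt0 -eqn0Ngt => /eqP->; exact: (forallP mM).
Qed.

Section Avoiding.
Variable A : {set vert G}.

(** The edges of the graph obtained by deleting the vertices of [A]. *)
Definition avoiding : {set edge G} :=
  [set e | (esrc e \notin A) && (etgt e \notin A)].

(** [M] is a maximum matching of the graph obtained by deleting [A]; the
    vertices of [A] remain as isolated vertices, never covered by [M]. *)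
Definition maxmatching M : bool :=
  [&& M \subset avoiding, matching M &
   [forall N : {set edge G}, (N \subset avoiding) && matching N ==> (#|N| <= #|M|)]].

Lemma maxmatchingP M : reflect
  [/\ M \subset avoiding, matching M &
   forall N, N \subset avoiding -> matching N -> #|N| <= #|M|]
  (maxmatching M).
Proof.
apply: (iffP and3P) => -[MA mM H]; split=> //.
  by move=> N NA mN; apply: (implyP (forallP H N)); rewrite NA.
by apply/forallP => N; apply/implyP => /andP[]; apply: H.
Qed.

Lemma maxmatching_exists : exists M, maxmatching M.
Proof.
have m0 : (set0 \subset avoiding) && matching set0.
  by rewrite sub0set /=; apply/forallP => v; rewrite deg_inE big_set0.
case: (@arg_maxnP _ set0 (fun M : {set edge G} => (M \subset avoiding) && matching M)
   (fun M => #|M|) m0) => M /andP[MA mM] H.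
by exists M; apply/maxmatchingP; split=> // N NA mN; apply: H; rewrite NA.
Qed.

Lemma maxmatching_eq M N : maxmatching M -> maxmatching N -> #|M| = #|N|.
Proof.
move=> /maxmatchingP[MA mM HM] /maxmatchingP[NA mN HN].
by apply/eqP; rewrite eqn_leq HN ?HM.
Qed.

(** An edge with both ends uncovered could be added to the matching. *)
Lemma maxmatching_edge M e : maxmatching M -> e \in avoiding -> esrc e != etgt e ->
  (esrc e \in covered M) || (etgt e \in covered M).
Proof.
move=> /maxmatchingP[MA mM HM] eA ne; rewrite -[_ || _]negbK negb_or.
apply/negP => /andP[sM tM].
have [|eM mM'] := @matching_setU1 M e mM ne; first by move=> v /orP[] /eqP<-.
have /(_ _ mM') := HM (e |: M).
by rewrite cardsU1 eM ltnn subUset sub1set eA => /(_ MA).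
Qed.

(** Being missed together by no maximum matching is transitive at a vertex [t]
    that some maximum matching misses. This is Gallai's exchange argument:
    if [M] misses [u] and [v], choose [N] missing [t] with [M :&: N] as large as
    possible. Then [M] covers another vertex [x], through an edge [e] to [y],
    that [N] misses; replacing by [e] the edge [f] of [N] at [y] gives a maximum
    matching missing [t] that shares more edges with [M]. *)
Lemma missed_trans t u v : u != v ->
  (exists2 N, maxmatching N & t \notin covered N) ->
  (forall M, maxmatching M -> (u \in covered M) || (t \in covered M)) ->
  (forall M, maxmatching M -> (t \in covered M) || (v \in covered M)) ->
  forall M, maxmatching M -> (u \in covered M) || (v \in covered M).
Proof.
move=> uv [N0 xN0 tN0] Hut Htv M xM; rewrite -[_ || _]negbK negb_or.
apply/negP => /andP[uM vM].
have N0P : maxmatching N0 && (t \notin covered N0) by rewrite xN0.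
case: (@arg_maxnP _ N0 (fun N : {set edge G} => maxmatching N && (t \notin covered N))
   (fun N => #|M :&: N|) N0P) => N /andP[xN tN] HN.
have tM : t \in covered M by have := Hut _ xM; rewrite (negbTE uM).
have uN : u \in covered N by have := Hut _ xN; rewrite (negbTE tN) orbF.
have vN : v \in covered N by have := Htv _ xN; rewrite (negbTE tN).
have /maxmatchingP[MA mM HM] := xM.
have /maxmatchingP[NA mN HNx] := xN.
(* [N] covers [u] and [v], which [M] misses; as both cover the same number of
   vertices, [M] covers at least two vertices that [N] misses. *)
have [x [xt xcM xcN]] : exists x, [/\ x != t, x \in covered M & x \notin covered N].
  have: 1 < #|covered M :\: covered N|.
    have: #|covered M :\: covered N| = #|covered N :\: covered M|.
      have := card_covered mM; have := card_covered mN.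
      rewrite (maxmatching_eq xM xN) => <-.
      rewrite -(cardsID (covered N) (covered M)) -(cardsID (covered M) (covered N)).
      by rewrite setIC => /addnI.
    move=> ->; have: [set u; v] \subset covered N :\: covered M.
      by apply/subsetP => w; rewrite in_set2 in_setD => /orP[]/eqP->; apply/andP.
    by move=> /subset_leq_card; rewrite cards2 uv.
  rewrite (cardsD1 t) in_setD tM tN ltnS => /card_gt0P[x].
  by rewrite in_setD1 in_setD => /and3P[]; exists x.
move: xcM; rewrite inE => /deg_in_gt0P[e eM xe].
have en := forallP mM (esrc e); rewrite (deg_inD1 _ eM) {1}/ends eqxx in en.
have ne : esrc e != etgt e by apply: contraTneq en => <-; rewrite eqxx.
have [y [ey xy]] : exists y, (forall w, ends e w = (x == w) + (y == w)) /\ x != y.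
  case/orP: xe => /eqP <-; first by exists (etgt e).
  by exists (esrc e); rewrite eq_sym; split=> // w; rewrite /ends addnC.
have eN : e \notin N.
  by apply: contraNN xcN => eN; rewrite inE; apply/deg_in_gt0P; exists e.
have eA := subsetP MA _ eM.
have yN : y \in covered N.
  have := maxmatching_edge xN eA ne.
  have [] : (esrc e = x \/ esrc e = y) /\ (etgt e = x \/ etgt e = y).
    have := ey (esrc e); have := ey (etgt e); rewrite /ends !eqxx.
    case: (x =P etgt e); case: (y =P etgt e); case: (x =P esrc e);
     case: (y =P esrc e) => //; rewrite ?[etgt e == _]eq_sym ?(negbTE ne) //;
     move=> *; split; auto.
  by case=> ->; case=> ->; rewrite ?(negbTE xcN) ?orbF ?orbb.
move: (yN); rewrite inE => /deg_in_gt0P[f fN yf].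
have fM : f \notin M.
  apply/negP => fM; have := forallP mM y; rewrite (deg_inD1 _ eM) ey eqxx.
  rewrite (_ : _ == _ = false) ?add0n ?add1n ?ltnS; last exact: negbTE.
  rewrite leqNgt => /negP; apply; apply/deg_in_gt0P; exists f => //.
  by rewrite !inE fM andbT; apply: contraNneq eN => <-.
have eNf : e \notin N :\ f by rewrite inE negb_and eN orbT.
have dN w : deg_in (e |: N :\ f) w + ends f w = (x == w) + (y == w) + deg_in N w.
  by rewrite deg_inU1 // ey (deg_inD1 _ fN) -addnA [deg_in _ w + _]addnC.
have xN' : maxmatching (e |: N :\ f).
  apply/maxmatchingP; split.
  - by rewrite subUset sub1set eA (subset_trans _ NA) // subsetDl.
  - apply/forallP => w; have := dN w; have := forallP mN w.
    have [<-|_] := eqVneq x w.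
      move: xcN; rewrite inE -eqn0Ngt => /eqP->; rewrite eq_sym (negbTE xy) => _ dx.
      by apply: leq_trans (leq_addr (ends f x) _) _; rewrite dx.
    have [<-|_] := eqVneq y w; last first.
      by move=> dw ew; apply: leq_trans (leq_addr (ends f w) _) _; rewrite ew.
    have : 0 < ends f y by rewrite ends_gt0.
    move: (deg_in N y) (ends f y) (deg_in _ y) => a b c; clear; lia.
  - move=> K KA mK; rewrite cardsU1 eNf; have := HNx _ KA mK.
    by rewrite (cardsD1 f N) fN.
have := HN (e |: N :\ f); rewrite xN' /=.
rewrite inE -eqn0Ngt; have := dN t; rewrite (negbTE xt).
have -> : y == t = false by apply: contraNF tN => /eqP<-.
move: (tN); rewrite inE -eqn0Ngt => /eqP-> /eqP; rewrite addn_eq0 => /andP[->] _ /(_ isT).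
have -> : M :&: (e |: N :\ f) = e |: (M :&: N).
  apply/setP => g; rewrite !inE; have [->|_] := eqVneq g e; first by rewrite eM.
  by have [->|_] := eqVneq g f; rewrite ?(negbTE fM).
by rewrite /= cardsU1 inE (negbTE eN) andbF add1n leqNgt leqnn.
Qed.

End Avoiding.
End Cuts.

(** * Perfect matchings and near-regular subgraphs *)

Section NearRegular.
Variables (k : nat) (D : mgraph).
Hypotheses (k0 : 0 < k) (hD : in_D k D).
Implicit Types (A : {set vert D}) (S M N : {set edge D}) (u v w : vert D).

Let cV : #|vert D| = 2 * k. Proof. by case: hD. Qed.
Let cE : #|edge D| = 3 * k. Proof. by case: hD. Qed.
Let deg3 v : deg_in setT v = 3. Proof. by case: hD. Qed.
Let tec : three_edge_connected D. Proof. by case: hD. Qed.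

Lemma set1_proper u : [set u] != setT.
Proof.
by apply/eqP => /(congr1 (fun X : {set _} => #|X|)); rewrite cards1 cardsT cV; lia.
Qed.

Lemma crossing1_sub u : crossing [set u] \subset star u.
Proof.
by apply/subsetP => e; rewrite !inE /incident; do 2!case: (_ == u).
Qed.

(** A loop at [u] would leave at most one edge between [u] and the rest. *)
Lemma in_D_loopless (e : edge D) : esrc e != etgt e.
Proof.
apply/eqP => et; set u := esrc e.
have C3 : 3 <= #|crossing [set u]|.
  by apply: cut_ge3 => //; rewrite ?set1_proper // -cards_eq0 cards1.
have: #|crossing [set u]| <= deg_in (setT :\ e) u.
  rewrite deg_inE -sum1_card [leqLHS]big_mkcond [leqRHS]big_mkcond.
  apply: leq_sum => f _; case: ifP => // fu.
  have -> : f \in setT :\ e.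
    by rewrite !inE andbT; apply: contraTneq fu => ->; rewrite !inE -et eqxx.
  by rewrite ends_gt0; have := subsetP (crossing1_sub u) _ fu; rewrite inE.
have := deg3 u; rewrite (@deg_inD1 _ e) ?inE // /ends -et eqxx.
by move: C3; lia.
Qed.

Lemma ends1 (e : edge D) u : ends e u = (e \in star u).
Proof.
rewrite inE /ends /incident; case: (esrc e =P u) => [<-|_]; last by case: eqP.
by rewrite eq_sym (negbTE (in_D_loopless e)).
Qed.

Lemma deg_in_star S u : deg_in S u = #|[set e in S | e \in star u]|.
Proof.
rewrite deg_inE -sum1_card [LHS]big_mkcond [RHS]big_mkcond.
by apply: eq_bigr => e _; rewrite ends1 inE; case: (e \in S) => //=; case: (_ \in _).
Qed.

Lemma card_star u : #|star u| = 3.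
Proof.
by rewrite -(deg3 u) deg_in_star; congr #|pred_of_set _|; apply/setP => e; rewrite !inE.
Qed.

Section Exchange.
Variables (A : {set vert D}) (M : {set edge D}).
Hypothesis missable :
  forall t, t \notin A -> exists2 N, maxmatching A N & t \notin covered N.
Hypothesis xM : maxmatching A M.

Let C u := [set w | connect (adj_in (avoiding A)) u w].

(** Gallai's lemma: if every vertex outside [A] is missed by some maximum
    matching of the graph obtained by deleting [A], then no such matching misses
    two vertices of the same component of that graph. *)
Lemma missed_connect u w : u \notin A -> w \in C u ->
  w \notin A /\
  (u = w \/ forall N, maxmatching A N -> (u \in covered N) || (w \in covered N)).
Proof.
move=> uA; rewrite inE => /connectP[p]; elim/last_ind: p w => [|p x IHp] w /=.
  by move=> _ ->; split; [|left].
rewrite rcons_path last_rcons => /andP[/IHp{}IHp /existsP[e /andP[eA exw]] ->{w}].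
have {IHp}[] := IHp _ erefl; set y := last u p in exw * => yA Huy.
have xA : x \notin A.
  by move: eA; rewrite inE => /andP[]; case/orP: exw => /andP[/eqP-> /eqP->].
have Hyx N : maxmatching A N -> (y \in covered N) || (x \in covered N).
  move=> /maxmatching_edge/(_ eA (in_D_loopless e)).
  by case/orP: exw => /andP[/eqP-> /eqP->] //; rewrite orbC.
split=> //; have [->|ux] := eqVneq u x; [by left|right].
case: Huy => [->//|Huy].
exact: missed_trans ux (missable yA) Huy Hyx.
Qed.

(** The components of the missed vertices are pairwise disjoint, and each sends
    at least three edges to [A]. Two missed vertices are assumed so that no
    component is the whole vertex set. *)
Lemma card_missed : 2 <= #|~: (A :|: covered M)| ->
  #|~: (A :|: covered M)| <= #|A|.
Proof.
set U := ~: _ => U2; rewrite -(leq_pmul2l (isT : 0 < 3)).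
have UA u : u \in U -> u \notin A by rewrite !inE negb_or => /andP[].
have UM u : u \in U -> u \notin covered M by rewrite in_setC in_setU negb_or => /andP[].
have CA u w : u \in U -> w \in C u -> w \notin A.
  by move=> /UA uA /(missed_connect uA)[].
have Ceq u v : u \in U -> v \in U -> v \in C u -> u = v.
  move=> uU vU /(missed_connect (UA _ uU))[_ [//|/(_ _ xM)]].
  by rewrite (negbTE (UM _ uU)) (negbTE (UM _ vU)).
have crossA u (e : edge D) : u \in U -> e \in crossing (C u) ->
   (esrc e \in C u /\ etgt e \in A) \/ (etgt e \in C u /\ esrc e \in A).
  move=> uU eC.
  have: e \notin avoiding A.
    apply: contraTN eC => eA; rewrite !inE negbK.
    by apply/eqP/same_connect_r/connect1/adj_in_ends; first exact: connect_adj_sym.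
  rewrite inE negb_and !negbK => /orP[] eA; [right|left]; split => //.
    by apply: contraTT eC => et; rewrite in_set (negbTE et);
      case Cs: (esrc e \in _) => //; rewrite (negbTE (CA _ _ uU Cs)) in eA.
  by apply: contraTT eC => et; rewrite in_set (negbTE et);
    case Cs: (etgt e \in _) => //; rewrite (negbTE (CA _ _ uU Cs)) in eA.
have C3 u : u \in U -> 3 <= #|crossing (C u)|.
  move=> uU; apply: cut_ge3 => //; first by apply/set0Pn; exists u; rewrite inE.
  move: U2; rewrite (cardsD1 u) uU => /card_gt0P[v]; rewrite in_setD1 => /andP[vu vU].
  apply: contraNneq vu => CT; rewrite eq_sym; apply/eqP/Ceq => //.
  by rewrite CT inE.
have CC u v x : x \in C u -> x \in C v -> v \in C u.
  rewrite !inE => ux vx; apply: connect_trans ux _.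
  by rewrite connect_adj_sym.
(* Count the edges between [A] and the components of [U]. *)
apply: (@leq_trans (\sum_(u in U) #|crossing (C u)|)).
  by rewrite mulnC -sum_nat_const; apply: leq_sum.
have -> : 3 * #|A| = \sum_(a in A) deg_in setT a.
  by rewrite (eq_bigr (fun=> 3)) // sum_nat_const mulnC.
under eq_bigr do rewrite -sum1_card big_mkcond.
under [leqRHS]eq_bigr do rewrite deg_inE big_mkcond.
rewrite exchange_big [leqRHS]exchange_big; apply: leq_sum => e _ /=.
rewrite -big_mkcondr sum1_card /=.
under [leqRHS]eq_bigr do rewrite inE.
have [->//|] := posnP #|[pred i in U | e \in crossing (C i)]|.
move=> /card_gt0P[u /andP[/= uU eu]].
apply: (@leq_trans 1).
  apply/card_le1_eqP => v w /andP[/= vU ev] /andP[/= wU ew].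
  suff: v \in C w by move/Ceq => ->.
  case: (crossA _ _ vU ev) (crossA _ _ wU ew) => -[vC vA] [] [wC wA].
  - exact: CC wC vC.
  - by have := CA _ _ vU vC; rewrite wA.
  - by have := CA _ _ vU vC; rewrite wA.
  - exact: CC wC vC.
have [a aA ea] : exists2 a, a \in A & 0 < ends e a.
  case: (crossA _ _ uU eu) => -[_ aA].
    by exists (etgt e); rewrite // ends_gt0 /incident eqxx orbT.
  by exists (esrc e); rewrite // ends_gt0 /incident eqxx.
by rewrite (bigD1 a) //=; apply: leq_trans ea (leq_addr _ _).
Qed.

End Exchange.

(** Petersen's theorem for 3-edge-connected cubic graphs. *)
Lemma petersen : exists M, [/\ matching M, #|M| = k & forall v, deg_in M v = 1].
Proof.
(* [P A]: deleting [A] lowers the matching number by at least [#|A|]. *)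
pose P A := [exists M : {set edge D}, [exists N : {set edge D},
  [&& maxmatching set0 N, maxmatching A M & #|M| + #|A| <= #|N|]]].
have [N0 xN0] := maxmatching_exists (set0 : {set vert D}).
have P0 : P set0.
  by apply/existsP; exists N0; apply/existsP; exists N0; rewrite xN0 cards0 addn0 /=.
case: (@arg_maxnP _ set0 P (fun A => #|A|) P0) => A.
case/existsP => M /existsP[N /and3P[xN xM MAN]] Amax.
have /maxmatchingP[MA mM HM] := xM.
have /maxmatchingP[_ mN _] := xN.
have cM := card_covered mM; have cN := card_covered mN.
have [kN|Nk] := leqP k #|N|.
  have cNT : covered N = setT.
    by apply/eqP; rewrite eqEcard subsetT cardsT cV cN leq_pmul2l.
  exists N; split=> //.
    by move: cN; rewrite cNT cardsT cV => /eqP; rewrite eqn_pmul2l // eq_sym => /eqP.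
  move=> v; apply/eqP; rewrite eqn_leq (forallP mN v) /=.
  by have := in_setT v; rewrite -cNT inE.
exfalso.
have disj : [disjoint A & covered M].
  rewrite disjoints_subset; apply/subsetP => a aA; rewrite inE; apply/negP.
  rewrite inE => /deg_in_gt0P[e /(subsetP MA)]; rewrite inE.
  by move=> + /orP[]/eqP ea; rewrite ea aA ?andbF.
have miss t : t \notin A -> exists2 N, maxmatching A N & t \notin covered N.
  move=> tA; have [M' xM'] := maxmatching_exists (t |: A).
  have /maxmatchingP[M'A mM' _] := xM'.
  have M'A2 : M' \subset avoiding A.
    by apply: subset_trans M'A _; apply/subsetP => e; rewrite !inE !negb_or
      => /andP[/andP[_ ->] /andP[_ ->]].
  have MM' : #|M| <= #|M'|.
    rewrite leqNgt; apply/negP => lt.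
    have PtA : P (t |: A).
      apply/existsP; exists M'; apply/existsP; exists N.
      rewrite xN xM' /= cardsU1 tA; move: MAN lt; clear; lia.
    by have := Amax _ PtA; rewrite /= cardsU1 tA add1n ltnn.
  exists M'.
    by apply/maxmatchingP; split=> // K KA mK; apply: leq_trans (HM _ KA mK) _.
  rewrite inE; apply/negP => /deg_in_gt0P[e /(subsetP M'A)]; rewrite !inE !negb_or.
  by move=> + /orP[]/eqP et; rewrite et eqxx ?andbF.
(* [#|M| + #|A| <= #|N| < k], so at least [#|A| + 2] vertices are missed. *)
have cU : #|~: (A :|: covered M)| + #|A| + 2 * #|M| = 2 * k.
  rewrite -cM -cV -(cardsC (A :|: covered M)) cardsU (_ : A :&: _ = set0); last first.
    by apply/eqP; rewrite setI_eq0.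
  by rewrite cards0 subn0; lia.
have := @card_missed A M miss xM.
by move: cU MAN Nk; lia.
Qed.

Lemma exists_subset_card (T : finType) (A : {set T}) n :
  n <= #|A| -> exists2 B : {set T}, B \subset A & #|B| = n.
Proof.
move=> nA; exists [set x in take n (enum A)].
  by apply/subsetP => x; rewrite inE => /mem_take; rewrite mem_enum.
rewrite cardsE; have /card_uniqP -> : uniq (take n (enum A)).
  exact/take_uniq/enum_uniq.
by rewrite size_takel // -cardE.
Qed.

(** Every number of edges up to [3k / 2] is that of a spanning subgraph whose
    degrees differ by at most one: they are [0] and [1] up to [k] edges, and [1]
    and [2] beyond. *)
Lemma near_regular_exists s : 2 * s <= 3 * k ->
  exists S, [/\ #|S| = s,
    s <= k -> forall v, deg_in S v <= 1
  & k < s -> forall v, 0 < deg_in S v <= 2].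
Proof.
move=> sk; have [M [mM cM dM]] := petersen.
have [s_le|s_gt] := leqP s k.
  have [|S SM cS] := @exists_subset_card _ M s; first by rewrite cM.
  exists S; split=> // _ v; first by rewrite -(dM v) deg_inS.
pose P N := matching N && (N \subset ~: M).
have P0 : P set0.
  by rewrite /P sub0set andbT; apply/forallP => v; rewrite deg_inE big_set0.
case: (@arg_maxnP _ set0 P (fun N => #|N|) P0) => N /andP[mN NM] Nmax.
have dC v : deg_in (~: M) v = 2.
  have := deg3 v; rewrite -(setUCr M) deg_in_setU ?dM => [[]//|].
  by rewrite disjoints_subset setCK.
(* Otherwise [e] could be added to [N]. *)
have hit (e : edge D) : e \in ~: M -> 0 < \sum_(v in covered N) ends e v.
  move=> eM; rewrite lt0n sum_nat_eq0; apply/negP => /forallP H.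
  have [|eN mN'] := @matching_setU1 _ N e mN (in_D_loopless e).
    by move=> v; rewrite -ends_gt0 lt0n => ve; apply/negP => vN;
      have := H v; rewrite vN /= (negbTE ve).
  have /implyP := Nmax (e |: N).
  by rewrite /P mN' subUset sub1set eM NM cardsU1 eN add1n /= ltnn.
(* The [2 * k] edges off [M] all meet the [2 * #|N|] covered vertices, each of
   which lies on two of them. *)
have cN : k <= 2 * #|N|.
  have : \sum_(e in ~: M) 1 <= \sum_(e in ~: M) \sum_(v in covered N) ends e v.
    exact: leq_sum.
  rewrite exchange_big sum1_card /=.
  rewrite (eq_bigr (fun=> 2)) => [|v _]; last by rewrite -deg_inE.
  by rewrite sum_nat_const card_covered //; have := cardsC M; rewrite cM cE; lia.
have [|N' N'N cN'] := @exists_subset_card _ N (s - k); first by lia.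
have dis : [disjoint M & N'].
  by rewrite disjoint_sym disjoints_subset (subset_trans N'N).
exists (M :|: N'); split=> [|//|_ v].
- by rewrite cardsU (_ : M :&: N' = set0) ?cards0 ?cN' ?cM;
    [lia|apply/eqP; rewrite setI_eq0].
- rewrite deg_in_setU // dM /= add1n ltnS.
  exact: leq_trans (deg_inS v N'N) (forallP mN v).
Qed.

End NearRegular.

(** * Isomorphisms *)

Section Iso.
Variables (G H : mgraph) (f : vert G -> vert H) (g : edge G -> edge H).
Hypotheses (bf : bijective f) (bg : bijective g).
Hypothesis fg : forall e, (esrc (g e) = f (esrc e) /\ etgt (g e) = f (etgt e))
               \/ (esrc (g e) = f (etgt e) /\ etgt (g e) = f (esrc e)).

Lemma iso_disconnecting (S : {set edge G}) : 0 < #|vert G| ->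
  disconnecting (g @: S) = disconnecting S.
Proof.
move=> G0; have H0 : 0 < #|vert H| by rewrite -(bij_eq_card bf).
have fI := bij_inj bf; have gI := bij_inj bg.
have cr (X : {set vert H}) e : (g e \in crossing X) = (e \in crossing (f @^-1: X)).
  by rewrite !inE; case: (fg e) => -[-> ->] //; rewrite eq_sym.
have [f' ff' f'f] := bf; have [g' gg' g'g] := bg.
apply/(disconnectingP _ H0)/(disconnectingP _ G0) => -[X [X0 XT XS]].
  exists (f @^-1: X); split.
  - by case/set0Pn: X0 => v vX; apply/set0Pn; exists (f' v); rewrite inE f'f.
  - apply: contraNneq XT => XT; apply/eqP/setP => v; rewrite -[v]f'f.
    by have := in_setT (f' v); rewrite -XT !inE.
  - by apply/subsetP => e; rewrite -cr => /(subsetP XS); rewrite mem_imset.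
have XE : f @^-1: (f @: X) = X by apply/setP => v; rewrite inE mem_imset.
exists (f @: X); split.
- by case/set0Pn: X0 => v vX; apply/set0Pn; exists (f v); rewrite mem_imset.
- by apply: contraNneq XT => XT; rewrite -XE XT; apply/eqP/setP => v; rewrite !inE.
- apply/subsetP => e; rewrite -[e]g'g cr XE => /(subsetP XS) eS.
  by rewrite mem_imset.
Qed.

End Iso.

Lemma mgraph_iso_d (G H : mgraph) i : mgraph_iso G H -> 0 < #|vert G| -> d G i = d H i.
Proof.
move=> [f [g [bf bg fg]]] G0; have gI := bij_inj bg; rewrite /d.
rewrite -(card_imset _ (imset_inj gI)); congr #|pred_of_set _|.
have [g' gg' g'g] := bg.
apply/setP => S; have -> : S = g @: (g' @: S).
  rewrite -imset_comp -[LHS]imset_id; apply: eq_imset => e.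
  by rewrite /= g'g.
rewrite mem_imset; last exact: imset_inj.
by rewrite !inE (iso_disconnecting bf bg fg) // (card_imset _ gI).
Qed.

Lemma mgraph_iso_refl (G : mgraph) : mgraph_iso G G.
Proof. by exists id, id; split; [exists id|exists id|move=> e; left]. Qed.

(** * Disconnecting sets of a weak subdivision *)

Section Subdivision.
Variables (D : mgraph) (l : edge D -> nat).
Hypothesis D0 : 0 < #|vert D|.
Let G := weak_subdivision l.
Implicit Types (T : {set edge G}) (Y : {set vert G}) (e : edge D).

(* The edge in position [i] on the path that replaces [e]. *)
Let mark e (i : 'I_(l e)) : edge G := Tagged (fun e => 'I_(l e)) i.

Lemma contract_surj (c : contracted_vert l) : exists v, c = contract l v.
Proof.
by case: c => X XP; have /codomP[v Xv] := XP; exists v; apply: val_inj.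
Qed.

Lemma contract_eqP u v :
  reflect (contract l u = contract l v) (connect (adj_in [set e | l e == 0]) u v).
Proof.
apply: (iffP idP) => [uv|/(congr1 val)/setP/(_ v)]; last first.
  by rewrite !inE connect0.
apply: val_inj; apply/setP => w; rewrite !inE.
exact: same_connect (@connect_adj_sym _ _) _ _ uv w.
Qed.

Lemma path_vert_last e : path_vert l e (l e) = inl (contract l (etgt e)).
Proof.
rewrite /path_vert; case le: {1}(l e) => [|n].
  congr inl; apply/contract_eqP/connect1/adj_in_ends; by rewrite inE le.
by rewrite insubF // le ltnn.
Qed.

Lemma path_vert_inner e (i : 'I_(l e).-1) :
  path_vert l e i.+1 = inr (Tagged (fun e => 'I_(l e).-1) i).
Proof. by rewrite /path_vert valK. Qed.

(** The vertex set of the subdivision with contracted vertices given by [a] and,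
    on the path of each edge [e], inner vertices in the positions given by
    [s e]. Position [0] is the source of [e] and position [l e] its target, so
    the inner vertex of index [z] is in position [z.+1]. *)
Definition side_set (a : pred (contracted_vert l)) (s : edge D -> pred nat)
    : {set vert G} :=
  [set w : vert G | match w : wsub_vert l with
             | inl c => a c
             | inr z => s (tag z) (tagged z).+1 end].

Lemma in_side_set a s e p :
  s e 0 = a (contract l (esrc e)) -> s e (l e) = a (contract l (etgt e)) ->
  p <= l e -> (path_vert l e p \in side_set a s) = s e p.
Proof.
move=> s0 sl; rewrite leq_eqVlt => /orP[/eqP->|].
  by rewrite path_vert_last inE.
case: p => [|p] pl; first by rewrite inE.
have pl' : p < (l e).-1 by lia.
by rewrite (path_vert_inner (Ordinal pl')) inE.
Qed.

Lemma in_crossing Y e (i : 'I_(l e)) : (mark i \in crossing Y) =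
  ((path_vert l e i \in Y) != (path_vert l e i.+1 \in Y)).
Proof. by rewrite inE. Qed.

Lemma subdiv_vert0 : 0 < #|vert G|.
Proof.
by have /card_gt0P[v _] := D0; apply/card_gt0P; exists (inl (contract l v)).
Qed.

(** Two edges on the same path cut off the vertices between them. *)
Lemma disconnecting_noninj T (x y : edge G) :
  x \in T -> y \in T -> x != y -> tag x = tag y -> disconnecting T.
Proof.
case: x y => e i [e' j] xT yT + /= ee'; case: e' / ee' j yT => j yT xy.
have {xy} ij : i != j :> nat by apply: contraNneq xy => /val_inj->.
wlog {ij} : i j xT yT / i < j.
  by move=> W; case: (ltngtP i j) ij => // ij _; [apply: W ij|apply: W ij].
move=> ij; apply/(disconnectingP _ subdiv_vert0).
pose s e' p := (e' == e) && (i < p <= j).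
have inY e' p : p <= l e' -> (path_vert l e' p \in side_set xpred0 s) = s e' p.
  apply: in_side_set; rewrite /s ?ltn0 ?andbF //.
  by have [->|//] := eqVneq e' e; rewrite [l e <= j]leqNgt (ltn_ord j) !andbF.
exists (side_set xpred0 s); split.
- apply/set0Pn; exists (path_vert l e j); rewrite inY; last exact/ltnW.
  by rewrite /s eqxx ij leqnn.
- apply/eqP => YT; have := in_setT (path_vert l e 0).
  by rewrite -YT inY // /s ltn0 andbF.
- apply/subsetP => -[e' p]; rewrite in_crossing !inY ?[p <= _]ltnW //.
  rewrite /s; have [ee'|//] := eqVneq e' e; move: p; rewrite ee' => p /=.
  have [/val_inj->//|pi] := eqVneq (p : nat) i.
  have [/val_inj->//|pj] := eqVneq (p : nat) j.
  by case/negP; apply/eqP; lia.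
Qed.

(** A predicate that changes at no step of an interval is constant on it. *)
Lemma const_path (b : pred nat) i j : i <= j ->
  (forall p, i <= p < j -> b p = b p.+1) -> b i = b j.
Proof.
move=> ij; rewrite -(subnKC ij); elim: (j - i) => [|n IHn] H; first by rewrite addn0.
rewrite addnS -H ?leq_addr ?addnS //=.
by apply: IHn => p /andP[ip pn]; apply: H; rewrite ip addnS leqW.
Qed.

(** A cut of [D] inside the projection of [T] lifts to the subdivision: each
    path that crosses the cut changes side at an edge of [T]. *)
Lemma disconnecting_lift T : disconnecting [set tag x | x in T] -> disconnecting T.
Proof.
case/(disconnectingP _ D0) => X [X0 XT XS]; apply/(disconnectingP _ subdiv_vert0).
(* Edges with an edge of [T] on their path have positive weight, so the cut
   does not separate vertices that are contracted together. *)
have zX u v : contract l u = contract l v -> (u \in X) = (v \in X).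
  move/contract_eqP/closed_connect; apply=> x y /existsP[e /andP[]]; rewrite inE => l0.
  have: e \notin crossing X.
    apply: contraTN l0 => /(subsetP XS)/imsetP[[e' i] _ ->] /=.
    by rewrite -lt0n (leq_trans _ (ltn_ord i)).
  rewrite inE negbK => /eqP exy.
  by case/orP => /andP[/eqP<- /eqP<-].
pose a c := [exists v in X, contract l v == c].
have aE v : a (contract l v) = (v \in X).
  apply/existsP/idP => [[u /andP[uX /eqP/zX]]|vX]; first by rewrite uX.
  by exists v; rewrite vX eqxx.
(* The position of an edge of [T] on the path of [e]; the default [0] serves
   paths that [T] misses, both ends of which are on the same side. *)
pose pos e := if [pick x in T | tag x == e] is Some x then (tagged x : nat) else 0.
have posP e : e \in crossing X ->
    pos e < l e /\ forall i : 'I_(l e), i = pos e :> nat -> mark i \in T.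
  move=> /(subsetP XS)/imsetP[x xT ex]; rewrite /pos; case: pickP; last first.
    by move/(_ x); rewrite xT ex eqxx.
  case=> e' i /= /andP[iT /eqP ee']; case: e / ee' ex => ex; split=> // j /val_inj ->.
  exact: iT.
pose s e p := if p <= pos e then esrc e \in X else etgt e \in X.
have inY e p : p <= l e -> (path_vert l e p \in side_set a s) = s e p.
  apply: in_side_set; rewrite aE /s //.
  case: ifP => // le_pos; have [/posP[]|] := boolP (e \in crossing X).
    by rewrite ltnNge le_pos.
  by rewrite inE negbK => /eqP.
have inlE v : (inl (contract l v) : vert G) \in side_set a s = (v \in X).
  by rewrite inE aE.
exists (side_set a s); split.
- by case/set0Pn: X0 => v vX; apply/set0Pn; exists (inl (contract l v)); rewrite inlE.
- apply: contraNneq XT => YT; apply/eqP/setP => v; rewrite -inlE YT !inE //.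
- apply/subsetP => -[e i]; rewrite in_crossing !inY ?[i <= _]ltnW // /s => H.
  have eX : e \in crossing X.
    by rewrite inE; move: H; do 2!case: (_ <= pos e); rewrite ?eqxx // eq_sym.
  apply: (posP e eX).2; apply/eqP; move: H.
  by case: (ltngtP (i : nat) (pos e)); rewrite ?eqxx.
Qed.

Lemma crossing_setC Y : crossing (~: Y) = crossing Y.
Proof. by apply/setP => x; rewrite !inE; case: (_ \in Y); case: (_ \in Y). Qed.

Section Injective.
Variable T : {set edge G}.
Hypothesis tagI : {in T &, injective (fun x : edge G => tag x)}.

(** A nonempty set of inner vertices of a path is separated from the rest by at
    least two edges of that path. *)
Lemma meets_branch Y : crossing Y \subset T -> Y != set0 ->
  exists v, (inl (contract l v) : vert G) \in Y.
Proof.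
move=> YT /set0Pn[[c|[e i]] wY].
  by have [v cv] := contract_surj c; exists v; rewrite -cv.
pose b p := path_vert l e p \in Y.
have bi : b i.+1 by rewrite /b path_vert_inner.
have bT (p : 'I_(l e)) : b p != b p.+1 -> mark p \in T.
  by move=> bp; apply: (subsetP YT); rewrite in_crossing.
have [b0|b0] := boolP (b 0); first by exists (esrc e).
have [bl|bl] := boolP (b (l e)); first by exists (etgt e); rewrite -path_vert_last.
have il : i.+1 < l e by have := ltn_ord i; lia.
have chg p q : p <= q -> q <= l e -> b p != b q ->
    exists2 r : 'I_(l e), p <= r < q & mark r \in T.
  move=> pq ql bpq.
  have [/existsP[r /andP[pr br]]|] :=
    boolP [exists r : 'I_(l e), (p <= r < q) && (b r != b r.+1)].
    by exists r => //; apply: bT.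
  rewrite negb_exists => /forallP H; case/eqP: bpq; apply: const_path => // r prq.
  have rl : r < l e by case/andP: prq => _ /leq_trans; apply.
  by have := H (Ordinal rl); rewrite /= prq /= negbK => /eqP.
have [r ri rT] : exists2 r : 'I_(l e), 0 <= r < i.+1 & mark r \in T.
  by apply: chg; rewrite ?bi ?(negbTE b0) // ltnW.
have [|r' ir' r'T] := chg _ _ (ltnW il) (leqnn _); first by rewrite bi (negbTE bl).
have /eqP := tagI rT r'T erefl; rewrite eq_Tagged /= => /eqP rr'.
by move: ri ir'; rewrite rr'; clear; lia.
Qed.

(** A cut of the subdivision inside [T] restricts to a cut of [D]. *)
Lemma disconnecting_proj : disconnecting T -> disconnecting [set tag x | x in T].
Proof.
case/(disconnectingP _ subdiv_vert0) => Y [Y0 YT YS]; apply/(disconnectingP _ D0).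
exists [set v | (inl (contract l v) : vert G) \in Y]; split.
- by have [v vY] := meets_branch YS Y0; apply/set0Pn; exists v; rewrite inE.
- have [||v vY] := @meets_branch (~: Y); first by rewrite crossing_setC.
    by apply: contraNneq YT => YT; rewrite -[Y]setCK YT setC0.
  apply/eqP => /setP/(_ v); rewrite !inE => vY'; move: vY; by rewrite inE vY'.
- apply/subsetP => e; apply: contraTT => eT; rewrite !inE negbK -path_vert_last.
  apply/eqP/(@const_path (fun p => path_vert l e p \in Y) 0 (l e)) => // p /= pl.
  apply/eqP; apply: contraNT eT => cr; apply/imsetP.
  exists (mark (Ordinal pl)) => //; apply: (subsetP YS); by rewrite in_crossing.
Qed.

End Injective.

Lemma card_fiber e : #|[pred x : wsub_edge l | tag x == e]| = l e.
Proof.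
rewrite -[RHS]card_ord -(@card_codom _ _ (fun i : 'I_(l e) => mark i)).
  apply: eq_card => -[e' i]; rewrite inE /=; apply/eqP/codomP => [ee'|[j]].
    by case: e / ee'; exists i.
  by move/(congr1 tag).
by move=> i j /eqP; rewrite eq_Tagged => /eqP.
Qed.

Lemma card_subdiv_edge : #|edge G| = total_weight l.
Proof.
rewrite /total_weight -sum1_card (partition_big (fun x : edge G => tag x) predT) //=.
by apply: eq_bigr => e _; rewrite sum1_card card_fiber.
Qed.

End Subdivision.

(** * The number of disconnecting triples *)

(** The number of transversals of the fibres of [h] over [B]; [x0] is a default
    value that makes transversals into functions defined everywhere. *)
Lemma card_lifts (I J : finType) (h : I -> J) (x0 : I) (B : {set J}) :
  #|[set T : {set I} | (#|T| == #|B|) && (h @: T == B)]| =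
  \prod_(e in B) #|[pred x | h x == e]|.
Proof.
pose F e := [pred x | h x == e].
have <- : #|pfamily x0 (mem B) F| = \prod_(e in B) #|F e|.
  by rewrite card_pfamily foldrE big_map big_enum.
have fam (f : {ffun J -> I}) : f \in pfamily x0 (mem B) F ->
  (forall e, e \in B -> h (f e) = e) /\ forall e, e \notin B -> f e = x0.
  move=> /pfamilyP[/supportP sf Ff]; split=> [e /Ff|e eB]; last exact: sf.
  by rewrite inE => /eqP.
have imI : {in pfamily x0 (mem B) F &, injective (fun f : {ffun J -> I} => f @: B)}.
  move=> f g /fam[hf f0] /fam[hg g0] fg; apply/ffunP => e.
  have [eB|eB] := boolP (e \in B); last by rewrite f0 ?g0.
  have : f e \in g @: B by rewrite -fg imset_f.
  by case/imsetP => e' e'B fe; rewrite fe; congr (g _); rewrite -(hf e eB) fe hg.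
rewrite -(card_in_imset imI); congr #|pred_of_set _|; apply/setP => T.
rewrite inE; apply/andP/imsetP => [[/eqP cT /eqP hT]|[f /fam[hf f0] ->]].
  have hI : {in T &, injective h} by apply/imset_injP; rewrite hT cT.
  pose f := [ffun e => if [pick x in T | h x == e] is Some x then x else x0].
  have fE e : e \in B -> f e \in T /\ h (f e) = e.
    rewrite -hT => /imsetP[x xT ->]; rewrite ffunE.
    by case: pickP => [y /andP[yT /eqP]|/(_ x)]; rewrite ?xT ?eqxx.
  exists f.
    apply/pfamilyP; split; last by move=> e /fE[_ he]; rewrite inE he.
    apply/supportP => e eB; rewrite ffunE; case: pickP => // x /andP[xT /eqP hx].
    by case/negP: eB; rewrite -hT -hx imset_f.
  apply/setP => x; apply/idP/imsetP => [xT|[e /fE[+ _] ->]//].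
  have hxB : h x \in B by rewrite -hT imset_f.
  by exists (h x) => //; have [fT hf] := fE _ hxB; apply: hI.
split.
  by rewrite card_in_imset // => e e' eB e'B ee'; rewrite -(hf e eB) ee' hf.
apply/eqP; rewrite -imset_comp -[RHS]imset_id; apply: eq_in_imset => e eB /=.
exact: hf.
Qed.

(** The third elementary symmetric function of the values of [l]. *)
Definition esym3 (I : finType) (l : I -> nat) : nat :=
  \sum_(B : {set I} | #|B| == 3) \prod_(e in B) l e.

Lemma esym3_perm (I : finType) (l l' : I -> nat) (h : I -> I) :
  injective h -> (forall e, l' (h e) = l e) -> esym3 l = esym3 l'.
Proof.
move=> hI hl; rewrite /esym3 [RHS](reindex_inj (imset_inj hI)) /=.
apply: eq_big => B; first by rewrite card_imset.
by move=> _; rewrite big_imset /=; [apply: eq_bigr|move=> x y _ _ /hI].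
Qed.

Section Formula.
Variables (k : nat) (D : mgraph).
Hypotheses (k2 : 1 < k) (hD : in_D k D) (hb : only_trivial_3bonds D).

Let k0 : 0 < k. Proof. exact: ltnW. Qed.
Let D0 : 0 < #|vert D|. Proof. by case: hD => -> _ _ _; rewrite muln_gt0. Qed.
Let tec : three_edge_connected D. Proof. by case: hD. Qed.

(** If [u] and [v] had the same star then no edge would leave [{u, v}]. *)
Lemma star_inj : injective (@star D).
Proof.
move=> u v uv; apply/eqP; apply/negPn/negP => nuv.
have: 3 <= #|crossing [set u; v]|.
  apply: cut_ge3 => //; first by apply/set0Pn; exists u; rewrite !inE eqxx.
  apply/eqP => /(congr1 (fun X : {set _} => #|X|)).
  by rewrite cards2 nuv cardsT; case: hD => ->; lia.
rewrite (_ : crossing _ = set0) ?cards0 //; apply/setP => e; rewrite !inE.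
have: ends e u = ends e v by rewrite !(ends1 k0 hD) uv.
rewrite /ends; case: (esrc e =P u) => [su|_]; case: (esrc e =P v) => [sv|_];
  case: (etgt e =P u) => [tu|_]; case: (etgt e =P v) => [tv|_] //;
  by case/eqP: nuv; congruence.
Qed.

(** The disconnecting triples of edges of [D] are the vertex stars. *)
Lemma disconnecting3 (S : {set edge D}) : #|S| = 3 ->
  disconnecting S = (S \in [set star u | u : vert D]).
Proof.
move=> S3; apply/idP/imsetP => [|[u _ ->]]; last first.
  apply/(disconnectingP _ D0); exists [set u]; split.
  - by apply/set0Pn; exists u; rewrite inE.
  - exact: set1_proper k0 hD u.
  - exact: crossing1_sub.
case/(disconnectingP _ D0) => X [X0 XT XS].
have cX : is_cut (crossing X) by apply/existsP; exists X; rewrite X0 XT eqxx.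
have XE : crossing X = S.
  by apply/eqP; rewrite eqEcard XS S3; apply: cut_ge3.
have bS : is_bond S.
  rewrite -XE; apply/minsetP; split=> // C /existsP[Y /and3P[Y0 YT /eqP CY]] CX.
  apply/eqP; rewrite eqEcard CX XE S3 CY; exact: cut_ge3.
by have [u ->] := hb bS S3; exists u.
Qed.

Lemma d3_formula (l : edge D -> nat) : 0 < total_weight l ->
  d (weak_subdivision l) 3 + esym3 l =
  'C(total_weight l, 3) + \sum_u \prod_(e in star u) l e.
Proof.
move=> m0; have /card_gt0P[x0 _] : 0 < #|edge (weak_subdivision l)|.
  by rewrite card_subdiv_edge.
pose tg (x : edge (weak_subdivision l)) : edge D := tag x.
(* [P]: all triples; [Q]: triples on three different paths; [R]: triples on the
   three paths of a star. *)
pose P := [set T : {set edge (weak_subdivision l)} | #|T| == 3].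
pose dP := [set T in P | disconnecting T].
pose Q := [set T in P | #|tg @: T| == 3].
pose R := [set T in Q | tg @: T \in [set star u | u : vert D]].
have lift (B : {set edge D}) : #|B| = 3 ->
    #|[set T : {set edge (weak_subdivision l)} | (#|T| == 3) && (tg @: T == B)]|
    = \prod_(e in B) l e.
  move=> B3; rewrite -{1}B3 (card_lifts _ x0).
  by apply: eq_bigr => e _; exact: card_fiber.
have disc T : T \in P -> disconnecting T =
    (T \notin Q) || (tg @: T \in [set star u | u : vert D]).
  move=> TP; rewrite in_set TP /=; move: (TP); rewrite inE => /eqP T3.
  have [t3|nt3] /= := eqVneq #|tg @: T| 3.
    rewrite -disconnecting3 //; apply/idP/idP; last exact: disconnecting_lift.
    by apply: disconnecting_proj => //; apply/imset_injP; rewrite T3 t3.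
  have: ~~ dinjectiveb tg T.
    apply: contra nt3 => /dinjectiveP tI; rewrite -[X in _ == X]T3.
    by apply/imset_injP => x y xT yT; apply: tI.
  by case/dinjectivePn => x xT [y /andP[/= nyx yT] xy];
    apply: disconnecting_noninj xT yT _ xy; rewrite // eq_sym.
have dE : d (weak_subdivision l) 3 = #|dP|.
  by rewrite /d; congr #|pred_of_set _|; apply/setP => T; rewrite !inE.
have QE : #|Q| = esym3 l.
  rewrite -sum1_card (partition_big (fun T : {set edge (weak_subdivision l)} => tg @: T)
    (fun B : {set edge D} => #|B| == 3)) /=.
    apply: eq_bigr => B /eqP B3; rewrite sum1_card -(lift _ B3).
    apply: eq_card => T; rewrite unfold_in /= !inE.
    by case: eqP => //= _; case: (_ =P B) => [->|]; rewrite ?B3 ?andbF.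
  by move=> T; rewrite !inE => /andP[].
have RE : #|R| = \sum_u \prod_(e in star u) l e.
  transitivity (\sum_(B in [set star u | u : vert D]) \prod_(e in B) l e); last first.
    by rewrite big_imset //= => u v _ _; exact: star_inj.
  rewrite -sum1_card (partition_big (fun T : {set edge (weak_subdivision l)} => tg @: T)
            (mem [set star u | u : vert D])) /=.
    apply: eq_bigr => B BS; rewrite sum1_card -lift.
      apply: eq_card => T; rewrite unfold_in /= !inE.
      case: (_ == 3) => //=; case: (_ =P B) => [->|]; rewrite ?andbF // BS.
      by case/imsetP: BS => u _ ->; rewrite (card_star k0 hD) eqxx.
    by case/imsetP: BS => u _ ->; rewrite (card_star k0 hD).
  by move=> T; rewrite in_set => /andP[].
have PE : #|P| = 'C(total_weight l, 3) by rewrite card_draws card_subdiv_edge.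
rewrite dE -QE -RE -PE -cardsUI; congr (_ + _);
  congr #|pred_of_set _|; apply/setP => T.
- rewrite in_setU [T \in dP]in_set; have [TP|TP] /= := boolP (T \in P).
    by rewrite disc //; case: (T \in Q); rewrite ?orbT.
  by rewrite in_set (negbTE TP).
- rewrite in_setI [T \in dP]in_set [T \in R]in_set.
  have [TP|TP] /= := boolP (T \in P); last by rewrite in_set (negbTE TP).
  by rewrite disc // andbC; case: (T \in Q).
Qed.

End Formula.

(** Two sets of the same size are exchanged by a permutation. *)
Lemma card_eq_perm (I : finType) (S S' : {set I}) : #|S| = #|S'| ->
  exists2 h : I -> I, injective h & forall x, (h x \in S') = (x \in S).
Proof.
move=> cS; pose en (A : {set I}) := enum A ++ enum (~: A).
have en_uniq A : uniq (en A).
  rewrite cat_uniq !enum_uniq andbT /=; apply/hasPn => x.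
  by rewrite !mem_enum inE.
have en_mem A x : x \in en A by rewrite mem_cat !mem_enum inE orbN.
have en_size A : size (en A) = #|I| by rewrite size_cat -!cardE cardsC.
have en_idx A x : (index x (en A) < #|A|) = (x \in A).
  rewrite index_cat mem_enum; case: ifP => xA.
    by rewrite cardE index_mem mem_enum.
  by rewrite -cardE ltnNge leq_addr.
have idx_lt A x : index x (en A) < #|I| by rewrite -(en_size A) index_mem.
exists (fun x => nth x (en S') (index x (en S))) => [x y|x].
  rewrite (set_nth_default x y) ?en_size // => /eqP.
  rewrite nth_uniq ?en_size // => /eqP ixy.
  by rewrite -(nth_index x (en_mem S x)) ixy nth_index.
by rewrite -en_idx index_uniq ?en_size // -cS en_idx.
Qed.

(** * Weightings with two values *)

(** A weighting with two values, [w] on [S] and [Q] elsewhere. *)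
Definition two_valued (E : finType) (Q w : nat) (S : {set E}) (e : E) : nat :=
  if e \in S then w else Q.

Lemma sum_two_valued (E : finType) Q w (S : {set E}) :
  \sum_e two_valued Q w S e = #|S| * w + (#|E| - #|S|) * Q.
Proof.
rewrite (bigID (mem S)) /=; congr (_ + _).
  by rewrite -sum_nat_const; apply: eq_bigr => e eS; rewrite /two_valued eS.
rewrite -cardsT -cardsDS ?subsetT // -sum_nat_const.
rewrite [LHS](eq_bigl (mem (setT :\: S))) => [|e]; last by rewrite /= !inE andbT.
by apply: eq_bigr => e; rewrite !inE andbT /two_valued => /negbTE->.
Qed.

(** The product of the weights at a vertex with [a] edges of weight [w] and
    [3 - a] edges of weight [Q]. *)
Definition vprod (Q w a : nat) : nat := w ^ a * Q ^ (3 - a).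

(** The affine function that agrees with [vprod Q w] at [t] and [t.+1]. *)
Definition chord (Q w t : nat) (a : nat) : int :=
  ((vprod Q w t)%:Z + (a%:Z - t%:Z) * ((vprod Q w t.+1)%:Z - (vprod Q w t)%:Z))%R.

(** Consecutive numbers, in either order. *)
Definition consecutive (Q w : nat) := (w == Q.+1) || (Q == w.+1).

(** The function [vprod Q w] is convex, so it lies above its chords. *)
Lemma chord_le Q w t a : consecutive Q w -> t <= 2 -> a <= 3 ->
  (chord Q w t a <= (vprod Q w a)%:Z)%R.
Proof.
rewrite /chord /vprod => /orP[]/eqP->;
  case: t => [|[|[|//]]] _; case: a => [|[|[|[|//]]]] _;
  rewrite ?subSS ?subn0 /= ?expnS ?expn0; nia.
Qed.

Lemma chord_eq Q w t a : (a == t) || (a == t.+1) ->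
  (chord Q w t a = (vprod Q w a)%:Z)%R.
Proof. by rewrite /chord => /orP[]/eqP->; lia. Qed.

(** For positive [Q] convexity is strict except when [w = 0]; then [vprod Q 0]
    vanishes from [1] on, and among the chords only the one at [0] is strictly
    below the function off its two points. *)
Lemma chord_lt Q w t a : consecutive Q w -> t <= 2 -> a <= 3 ->
  0 < Q -> (t = 0 \/ 0 < w) -> ~~ ((a == t) || (a == t.+1)) ->
  (chord Q w t a < (vprod Q w a)%:Z)%R.
Proof.
rewrite /chord /vprod => /orP[]/eqP->;
  case: t => [|[|[|//]]] _; case: a => [|[|[|[|//]]]] _ //;
  rewrite ?subSS ?subn0 /= ?expnS ?expn0 => Q0 [//|w0] _; nia.
Qed.

(** The degrees of the spanning subgraph with edge set [S] pairwise differ by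
    at most one. *)
Definition near_regular (D : mgraph) (S : {set edge D}) : Prop :=
  forall u v : vert D, deg_in S u <= deg_in S v + 1.

Lemma remainder_unique (c n q : nat) (a r : int) :
  (c%:Z * n%:Z + a = c%:Z * q%:Z + r)%R -> (- c%:Z < a - r < c%:Z)%R ->
  n = q /\ r = a.
Proof.
move=> E b; have nq : n = q.
  have [lt|gt|//] := ltngtP n q.
    have : c * n + c <= c * q by rewrite addnC -mulnS leq_mul2l lt orbT.
    by move: E b; clear; lia.
  have : c * q + c <= c * n by rewrite addnC -mulnS leq_mul2l gt orbT.
  by move: E b; clear; lia.
by move: E; rewrite nq; clear; split=> //; lia.
Qed.

(** * Minimization *)

Section Main.
Variables (k : nat) (D : mgraph).
Hypotheses (k2 : 1 < k) (hD : in_D k D) (hb : only_trivial_3bonds D).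
Implicit Types (S : {set edge D}) (u v : vert D).

Let k0 : 0 < k. Proof. exact: ltnW. Qed.
Let cV : #|vert D| = 2 * k. Proof. by case: hD. Qed.
Let cE : #|edge D| = 3 * k. Proof. by case: hD. Qed.
Let D0 : 0 < #|vert D|. Proof. by rewrite cV muln_gt0. Qed.

Lemma deg_in_le3 S u : deg_in S u <= 3.
Proof. by case: hD => _ _ /(_ u) <- _; apply/deg_inS/subsetT. Qed.

Lemma prod_star_two_valued Q w S u :
  \prod_(e in star u) two_valued Q w S e = vprod Q w (deg_in S u).
Proof.
rewrite (bigID (mem S)) /= /vprod; congr (_ * _).
  rewrite (eq_bigr (fun=> w)) => [|e /andP[_ eS]]; last by rewrite /two_valued eS.
  rewrite prod_nat_const (deg_in_star k0 hD); congr (_ ^ _).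
  by apply: eq_card => e; rewrite [in RHS]inE andbC.
rewrite (eq_bigr (fun=> Q)) => [|e /andP[_ /negbTE eS]]; last by rewrite /two_valued eS.
rewrite prod_nat_const; congr (_ ^ _).
rewrite -(card_star k0 hD u) -(cardsID S (star u)) (deg_in_star k0 hD).
rewrite (_ : [set e in S | e \in star u] = star u :&: S) ?addKn.
  by apply: eq_card => e; rewrite [in RHS]inE andbC.
by apply/setP => e; rewrite !inE andbC.
Qed.

Lemma posz_sum (I : finType) (P : pred I) (F : I -> nat) :
  ((\sum_(i | P i) F i)%N%:Z = \sum_(i | P i) (F i)%:Z)%R.
Proof. exact: (big_morph Posz PoszD). Qed.

(** By the handshake lemma this sum depends on [S] through its size only. *)
Lemma sum_chord Q w t S : (\sum_u chord Q w t (deg_in S u) =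
  2 * k%:Z * (vprod Q w t)%:Z +
  (2 * #|S|%:Z - 2 * k%:Z * t%:Z) * ((vprod Q w t.+1)%:Z - (vprod Q w t)%:Z))%R.
Proof.
rewrite /chord big_split /= -big_distrl /= big_split /=.
rewrite -(posz_sum xpredT (deg_in S)) sum_deg_in.
have mulZn (x : int) n : (x *+ n = n%:Z * x)%R by rewrite -mulr_natl natz.
rewrite !sumr_const cV !mulZn; lia.
Qed.

Lemma vsum_ge Q w t S : consecutive Q w -> t <= 2 ->
  (\sum_u chord Q w t (deg_in S u) <= (\sum_u vprod Q w (deg_in S u))%:Z)%R.
Proof.
move=> cQ t2; rewrite posz_sum; apply: ler_sum => u _.
by apply: chord_le => //; apply: deg_in_le3.
Qed.

Lemma vsum_eq Q w t S :
  (forall u, (deg_in S u == t) || (deg_in S u == t.+1)) ->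
  ((\sum_u vprod Q w (deg_in S u))%:Z = \sum_u chord Q w t (deg_in S u))%R.
Proof.
move=> St; by rewrite posz_sum; apply: eq_bigr => u _; rewrite chord_eq.
Qed.

Lemma vsum_le_near_regular Q w S S' : consecutive Q w ->
  near_regular S -> #|S| = #|S'| ->
  \sum_u vprod Q w (deg_in S u) <= \sum_u vprod Q w (deg_in S' u).
Proof.
move=> cQ nS cS; have [u0 _] : exists u, u \in vert D by apply/card_gt0P.
case: (@arg_minnP _ u0 predT (deg_in S) isT) => u1 _ umin.
(* If all degrees are 3, the chord through 2 and 3 is used. *)
pose t := minn (deg_in S u1) 2.
have St u : (deg_in S u == t) || (deg_in S u == t.+1).
  have := umin u isT; have := nS u u1; have := deg_in_le3 S u.
  by rewrite /t; clear; lia.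
have t2 : t <= 2 by apply: geq_minr.
rewrite -lez_nat (vsum_eq _ _ St) sum_chord cS -sum_chord; exact: vsum_ge.
Qed.

(** If the chord bound is attained by some [S'], a set that does at least as well
    attains it at every vertex. *)
Lemma vsum_min_near_regular Q w t S S' : consecutive Q w -> t <= 2 ->
  0 < Q -> (t = 0 \/ 0 < w) ->
  (forall u, (deg_in S' u == t) || (deg_in S' u == t.+1)) -> #|S| = #|S'| ->
  \sum_u vprod Q w (deg_in S u) <= \sum_u vprod Q w (deg_in S' u) ->
  near_regular S.
Proof.
move=> cQ t2 Q0 tw St' cS leSS'.
have St u : (deg_in S u == t) || (deg_in S u == t.+1).
  apply/negPn/negP => nu; have := chord_lt cQ t2 (deg_in_le3 S u) Q0 tw nu.
  apply/negP; rewrite -leNgt.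
  move: leSS'; rewrite -lez_nat (vsum_eq _ _ St') sum_chord -cS -sum_chord.
  rewrite posz_sum (bigD1 u) // [X in (_ <= X)%R](bigD1 u) //= => le1.
  have le2 : (\sum_(v | v != u) chord Q w t (deg_in S v) <=
              \sum_(v | v != u) (vprod Q w (deg_in S v))%:Z)%R.
    by apply: ler_sum => v _; rewrite chord_le // deg_in_le3.
  by rewrite -(lerD2r (\sum_(v | v != u) chord Q w t (deg_in S v))%R);
    apply: le_trans le1; rewrite lerD2l.
by move=> u v; have := St u; have := St v; clear; lia.
Qed.

Section Weights.
Variables (m : nat) (q r : int).
Hypotheses (hqr : (m%:Z = 3 * k%:Z * q + r)%R)
  (hr : (- (3 * k%:Z) < 2 * r <= 3 * k%:Z)%R).

(* Balanced weightings take the value [w] on [s] edges and [Q] elsewhere. *)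
Let s : nat := `|r|.
Let Q : nat := `|q|.
Let w : nat := if (0 <= r)%R then Q.+1 else Q.-1.

Lemma q_nat : q = Q%:Z%R /\ ((r < 0)%R -> 0 < Q).
Proof. by rewrite /Q; move: hqr hr k0; clear; nia. Qed.

Lemma consecutive_Qw : consecutive Q w.
Proof.
rewrite /consecutive /w; have [_] := q_nat; case: lerP => [|_ /(_ isT)]; lia.
Qed.

(** With [n] the least weight and [A] the set of edges of weight [n.+1], the total
    weight is [3 * k * n + #|A|]; according as [#|A|] is at most [3k / 2] or not,
    [n] or [n.+1] is the nearest quotient [q]. *)
Lemma balanced_two_valued (l : edge D -> nat) : balanced l -> total_weight l = m ->
  exists2 S : {set edge D}, #|S| = s & l =1 two_valued Q w S.
Proof.
move=> bl tl; have [e0 _] : exists e, e \in edge D.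
  by apply/card_gt0P; rewrite cE muln_gt0.
case: (@arg_minnP _ e0 predT l isT) => e1 _ emin.
pose n := l e1; pose A := [set e | l e == n.+1].
have lA : l =1 two_valued n n.+1 A.
  move=> e; rewrite /two_valued inE; have := bl e e1; have := emin e isT.
  by rewrite -/n; case: eqP => //; clear; lia.
have lA' : l =1 two_valued n.+1 n (~: A).
  by move=> e; rewrite lA /two_valued in_setC; case: (_ \in A).
have A3 : #|A| < 3 * k.
  rewrite -cE -cardsT; apply: proper_card; rewrite properT.
  by apply/eqP => /setP/(_ e1); rewrite !inE; rewrite -/n; lia.
have tA : #|A| * n.+1 + (3 * k - #|A|) * n = m.
  by rewrite -tl /total_weight -cE -sum_two_valued; apply: eq_bigr => e _.
have mA : m = 3 * k * n + #|A|.
  rewrite -tA mulnBl mulnS.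
  have : #|A| * n <= 3 * k * n by rewrite leq_mul2r ltnW ?orbT.
  by clear; lia.
have [qQ rQ] := q_nat.
have [Ak|Ak] := leqP (2 * #|A|) (3 * k).
  have [nQ rA] : n = Q /\ (r = #|A|%:Z)%R.
    apply: (@remainder_unique (3 * k)).
      by move: hqr; rewrite qQ mA; clear; lia.
    by move: hr Ak; clear; lia.
  by exists A; rewrite /s ?rA // /w rA -nQ.
have cA : #|~: A| = 3 * k - #|A| by rewrite -cE -(cardsC A) addKn.
have [nQ rA] : n.+1 = Q /\ (r = - #|~: A|%:Z)%R.
  apply: (@remainder_unique (3 * k)); rewrite cA.
    by move: hqr A3; rewrite qQ mA; clear; lia.
  by move: hr A3 Ak; clear; lia.
exists (~: A); first by rewrite /s rA abszN.
have -> : w = n by rewrite /w -nQ rA cA; case: lerP => //; move: A3; clear; lia.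
by rewrite -nQ.
Qed.

Lemma balanced_pi_vE (l : edge D -> nat) S : l =1 two_valued Q w S -> #|S| = s ->
  balanced_pi_v l q <-> near_regular S.
Proof.
move=> lS cS; have [qQ rQ] := q_nat.
have set_eq (P : pred (edge D)) u : P =1 mem S ->
    #|[set e in star u | P e]| = deg_in S u.
  move=> PS; rewrite (deg_in_star k0 hD); apply: eq_card => e.
  by rewrite !inE PS andbC.
have set_0 (P : pred (edge D)) u : P =1 pred0 -> #|[set e in star u | P e]| = 0.
  by move=> P0; apply/eqP; rewrite cards_eq0; apply/eqP/setP => e; rewrite !inE P0 andbF.
have [r0|r0] := lerP 0 r.
  have wE : w = Q.+1 by rewrite /w r0.
  have piE u : pi_v l q u = (deg_in S u)%:Z%R.
    rewrite /pi_v (set_eq (fun e => ((l e)%:Z == q + 1)%R)) => [|e].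
      rewrite (set_0 (fun e => ((l e)%:Z == q - 1)%R)) ?subr0 // => e.
      by rewrite lS /two_valued wE /= qQ; case: ifP => _; lia.
    by rewrite lS /two_valued wE qQ /=; case: ifP => _; lia.
  split=> [H u v|H u v]; last by have := H u v; have := H v u; rewrite !piE; lia.
  by have := H u v; rewrite !piE; lia.
have Q0 := rQ r0.
have wE : w = Q.-1 by rewrite /w; case: lerP r0.
have piE u : pi_v l q u = (- (deg_in S u)%:Z)%R.
  rewrite /pi_v (set_eq (fun e => ((l e)%:Z == q - 1)%R)) => [|e].
    rewrite (set_0 (fun e => ((l e)%:Z == q + 1)%R)) ?sub0r // => e.
    by rewrite lS /two_valued wE /= qQ; case: ifP => _; lia.
  by rewrite lS /two_valued wE qQ /=; case: ifP => _; lia.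
split=> [H u v|H u v]; last by have := H u v; have := H v u; rewrite !piE; lia.
by have := H u v; rewrite !piE; lia.
Qed.

(** The symmetric function of the weights is the same for [l] and [l']. *)
Lemma d3_le (l l' : edge D -> nat) S S' : 0 < m ->
  total_weight l = m -> total_weight l' = m ->
  l =1 two_valued Q w S -> l' =1 two_valued Q w S' -> #|S| = #|S'| ->
  (d (weak_subdivision l) 3 <= d (weak_subdivision l') 3) =
  (\sum_u vprod Q w (deg_in S u) <= \sum_u vprod Q w (deg_in S' u)).
Proof.
move=> m0 tl tl' lS lS' cS.
have sum_prod (l1 : edge D -> nat) S1 : l1 =1 two_valued Q w S1 ->
    \sum_u \prod_(e in star u) l1 e = \sum_u vprod Q w (deg_in S1 u).
  move=> lS1; apply: eq_bigr => u _; rewrite -prod_star_two_valued.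
  by apply: eq_bigr => e _.
have := @d3_formula k D k2 hD hb l; have := @d3_formula k D k2 hD hb l'.
rewrite tl tl' (sum_prod _ _ lS) (sum_prod _ _ lS').
have [h hI hS] := card_eq_perm cS.
have -> : esym3 l' = esym3 l.
  by apply/esym/(esym3_perm hI) => e; rewrite lS lS' /two_valued hS.
by move=> /(_ m0) + /(_ m0); clear; lia.
Qed.

(** When [m >= 2k], zero weights occur only for [Q = 1] and at most [k] edges of
    weight [0]; these form a matching by the degree hypothesis, and a matching contains no
    cycle. *)
Lemma two_valued_weighting S : 2 * k <= m -> #|S| = s ->
  (s <= k -> forall v, deg_in S v <= 1) ->
  0 < Q /\ (0 < w \/ s <= k) /\ weighting (two_valued Q w S).
Proof.
move=> km cS dS; have [qQ rQ] := q_nat.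
have Q0 : 0 < Q by move: hqr hr km k2; rewrite qQ; clear; nia.
have wk : 0 < w \/ s <= k.
  rewrite /w; case: lerP => [|r0]; first by left.
  have [Q1|Q1] := ltnP 1 Q; first by left; lia.
  have {}Q1 : Q = 1 by lia.
  by right; move: hqr km r0; rewrite /s qQ Q1; clear; lia.
do 2!split=> //; move=> C [C0 C2 _]; rewrite lt0n sum_nat_eq0.
apply/negP => /forallP lC.
have {}lC e : e \in C -> two_valued Q w S e = 0.
  by move=> eC; apply/eqP; have := lC e; rewrite eC.
have CS : C \subset S.
  apply/subsetP => e /lC; rewrite /two_valued; case: ifP => // _ Q00.
  by rewrite Q00 in Q0.
have [e eC] := set0Pn _ C0.
case: wk => [w0|sk].
  by have := lC e eC; rewrite /two_valued (subsetP CS) // => w00; rewrite w00 in w0.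
have ve : 0 < deg_in C (esrc e).
  by apply/deg_in_gt0P; exists e; rewrite // /incident eqxx.
by have := leq_trans (deg_inS (esrc e) CS) (dS sk _); rewrite C2.
Qed.

Lemma in_B_two_valued (H : mgraph) : in_B m D H ->
  exists (l : edge D -> nat) (S : {set edge D}),
    [/\ total_weight l = m, #|S| = s, l =1 two_valued Q w S
      & d H 3 = d (weak_subdivision l) 3].
Proof.
move=> [eH [l [_ bl iso]]].
have H0 : 0 < #|vert H|.
  have [f [_ [bf _ _]]] := iso.
  by rewrite (bij_eq_card bf) subdiv_vert0.
have tl : total_weight l = m.
  by have [_ [g [_ bg _]]] := iso; rewrite -eH (bij_eq_card bg) card_subdiv_edge.
have [S cS lS] := balanced_two_valued bl tl.
by exists l, S; split=> //; apply: mgraph_iso_d.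
Qed.

Lemma in_B_weak_subdivision (l : edge D -> nat) :
  weighting l -> balanced l -> total_weight l = m -> in_B m D (weak_subdivision l).
Proof.
move=> wl bl tl; split; first by rewrite card_subdiv_edge.
by exists l; split=> //; apply: mgraph_iso_refl.
Qed.

Lemma minimizer_near_regular (l : edge D -> nat) S : 0 < m ->
  weighting l -> balanced l -> total_weight l = m -> 
  l =1 two_valued Q w S -> #|S| = s ->
  (near_regular S -> minimizes_d3_in_B m D (weak_subdivision l)) /\
  (2 * k <= m -> minimizes_d3_in_B m D (weak_subdivision l) -> near_regular S).
Proof.
move=> m0 wl bl tl lS cS; split=> [nS|km [_ minl]].
  split=> [|H /in_B_two_valued[l' [S' [tl' cS' lS' ->]]]].
    exact: in_B_weak_subdivision.
  rewrite (d3_le m0 tl tl' lS lS') ?cS //.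
  by apply: vsum_le_near_regular consecutive_Qw nS _; rewrite cS.
have sk : 2 * s <= 3 * k by move: hr; rewrite /s; clear; lia.
have [S' [cS' d1 d2]] := near_regular_exists k0 hD sk.
have [Q0 [wk wS']] := two_valued_weighting km cS' d1.
pose l' := two_valued Q w S'.
have tl' : total_weight l' = m.
  rewrite -tl /total_weight /l' (eq_bigr _ (fun e _ => lS e)).
  by rewrite !sum_two_valued cS cS'.
have bl' : balanced l'.
  move=> e f; rewrite /l' /two_valued; have := consecutive_Qw; rewrite /consecutive.
  by do 2!case: ifP => _; clear; lia.
have := minl _ (in_B_weak_subdivision wS' bl' tl').
rewrite (d3_le (S := S) (S' := S') m0 tl tl') ?cS //.
apply: (@vsum_min_near_regular Q w (if s <= k then 0 else 1)) => //.
- exact: consecutive_Qw.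
- by case: ifP.
- by case: wk => [|->]; [right|left].
- move=> u; case: leqP => [/d1/(_ u)|/d2/(_ u)]; clear; lia.
- by rewrite cS.
Qed.

End Weights.
End Main.

Theorem proposition6p2 (m k : nat) (hk : 2 <= k) (hm : k < m)
  (D : mgraph) (hD : in_D k D) (hbonds : only_trivial_3bonds D)
  (q r : int) (hqr : (m%:Z = 3 * k%:Z * q + r)%R)
  (hr : (- (3 * k%:Z) < 2 * r <= 3 * k%:Z)%R)
  (l : edge D -> nat) (hl : weighting l) (hbal : balanced l)
  (htot : total_weight l = m) :
  (balanced_pi_v l q -> minimizes_d3_in_B m D (weak_subdivision l)) /\
  (2 * k <= m ->
     (minimizes_d3_in_B m D (weak_subdivision l) <-> balanced_pi_v l q)).
Proof.
have m0 : 0 < m by apply: leq_trans hm.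
have [S cS lS] := balanced_two_valued hk hD hqr hr hbal htot.
have [minS Smin] := minimizer_near_regular hk hD hbonds hqr hr m0 hl hbal htot lS cS.
have piS := balanced_pi_vE hk hD hqr hr lS cS.
split=> [/piS/minS//|km]; split=> [/(Smin km)/piS//|/piS/minS//].
Qed.
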